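(* Let $M\in\mathbb{R}^{m\times n}$ and $S\in\mathbb{R}^{d\times m}$ with $n\le d\le m$, and let $c=\kappa(S\,|\,\mathrm{range}(M))$ be finite; let $k=\mathrm{rank}(SM)=\mathrm{rank}(M)$. If $\mathtt{qrcp}$ satisfies the strong RRQR property for $SM$ with coefficients $(f_\ell)_{\ell=1}^k$ and $(g_\ell)_{\ell=1}^k$, then $\mathtt{cqrrpt\_core}(\cdot,S)$ (which uses $\mathtt{qrcp}$ as its subroutine) satisfies the strong RRQR property for $M$ with coefficients $(c f_\ell)_{\ell=1}^k$ and $(g_\ell+c f_\ell^2)_{\ell=1}^k$.
   Context: All matrices are real, $X^*$ denotes the transpose, arithmetic is exact, and singular values are in decreasing order. ''Orthonormal matrix'' means a matrix with orthonormal columns. Restricted condition number: for a linear subspace $L\subset\mathbb{R}^m$ and any orthonormal matrix $U$ with range $L$, $\kappa(S|L)$ is the ratio of the largest to the smallest singular value of $SU$ (infinite if the smallest is zero). Column-pivoted QR decomposition: for a rank-$k$ matrix $X$ with $n$ columns, it consists of an orthonormal $Q$, an upper-trapezoidal $R$, and a permutation vector $J$ of $\{1,\dots,n\}$ such that $X[:,J]=Q_kR_k$, with $Q_k$ the first $k$ columns of $Q$ and $R_k$ the first $k$ rows of $R$. A QRCP algorithm (such as $\mathtt{qrcp}$ or $\mathtt{cqrrpt\_core}(\cdot,S)$) returns such $[Q,R,J]$; below, $R$ is taken with $k$ rows. Blocks: for a $k\times n$ upper-trapezoidal $R$ and $\ell\le k$, $A_\ell=R[1{:}\ell,1{:}\ell]$,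 $B_\ell=R[1{:}\ell,\ell{+}1{:}n]$, $C_\ell=R[\ell{+}1{:}k,\ell{+}1{:}n]$. Strong RRQR property: let $X$ have $n$ columns, at least as many rows, and rank $k$, and let $f_1,\dots,f_k\ge 1$. A QRCP algorithm has the strong RRQR property for $X$ with coefficients $(f_\ell)_{\ell=1}^k$ and $(g_\ell)_{\ell=1}^k$ if the R-factor it returns for $X$ satisfies, for all $\ell\le k$, $$\sigma_j(A_\ell)\ge \frac{\sigma_j(X)}{f_\ell}\ \ (j\le \ell),\qquad \sigma_j(C_\ell)\le f_\ell\,\sigma_{\ell+j}(X)\ \ (j\le k-\ell),\qquad \|A_\ell^{-1}B_\ell\|_2\le g_\ell.$$ Algorithm $\mathtt{cqrrpt\_core}(M,S)$: (1) $M^{\mathrm{sk}}=SM$; (2) $[Q^{\mathrm{sk}},R^{\mathrm{sk}},J]=\mathtt{qrcp}(M^{\mathrm{sk}})$; (3) $k=\mathrm{rank}(R^{\mathrm{sk}})$; (4) $M^{\mathrm{pre}}=M[:,J[1{:}k]]\,(R^{\mathrm{sk}}[1{:}k,1{:}k])^{-1}$; (5) $G=(M^{\mathrm{pre}})^*M^{\mathrm{pre}}$; (6) $R^{\mathrm{pre}}=\mathtt{chol}(G)$, the upper-triangular Cholesky factor with $G=(R^{\mathrm{pre}})^*R^{\mathrm{pre}}$; (7) $Q_k=M^{\mathrm{pre}}(R^{\mathrm{pre}})^{-1}$; (8) $R_k=R^{\mathrm{pre}}R^{\mathrm{sk}}[1{:}k,:]$; return $Q_k,R_k,J$. *)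

(* Defs.v *)
From HB Require Import structures.
From mathcomp Require Import all_boot all_order all_algebra all_fingroup.
From mathcomp Require Import polyrcf.
From mathcomp Require Import mathcomp_extra boolp classical_sets reals ereal.
Set Implicit Arguments.
Unset Strict Implicit.
Unset Printing Implicit Defensive.
Import Order.TTheory GRing.Theory Num.Theory.
Local Open Scope ring_scope.
Local Open Scope classical_set_scope.

Section SingularValues.
Variable R : realType.

(* The real eigenvalues of A, repeated according to algebraic multiplicity
   and sorted in decreasing order. *)
Definition eigenvalues n (A : 'M[R]_n) : seq R :=
  sort >=%R (flatten [seq nseq (mup x (char_poly A)) x
                     | x <- rootsR (char_poly A)]).

(* A matrix with m rows and n columns has min(m, n) singular values; the
   other eigenvalues of X^T X vanish. *)
Definition singular_values m n (X : 'M[R]_(m, n)) : seq R :=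
  take (minn m n) [seq Num.sqrt x | x <- eigenvalues (X^T *m X)].

(* Numbered from 1, and 0 past the last one. *)
Definition sigma (j : nat) m n (X : 'M[R]_(m, n)) : R :=
  nth 0 (singular_values X) j.-1.

Definition orthonormal m r (U : 'M[R]_(m, r)) : Prop := U^T *m U = 1%:M.

(* Ratio of the extreme singular values. The default value 1 is used only for
   matrices without rows or columns, for which the ratio is set to 1. *)
Definition cond m n (X : 'M[R]_(m, n)) : \bar R :=
  let s := singular_values X in
  if last 1 s == 0 then +oo%E else (head 1 s / last 1 s)%:E.

(* A linear subspace of R^m is represented by the row space of a matrix L with
   m columns, so that range(M) is represented by M^T. *)
Definition orthonormal_basis p m (L : 'M[R]_(p, m)) : 'M[R]_(m, \rank L) :=
  xget 0 [set U : 'M[R]_(m, \rank L) | orthonormal U /\ (U^T == L)%MS].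

(* By kappaE below, any orthonormal U whose range is L gives the same value. *)
Definition kappa d m p (S : 'M[R]_(d, m)) (L : 'M[R]_(p, m)) : \bar R :=
  cond (S *m orthonormal_basis L).

Definition norm2 n (x : 'cV[R]_n) : R := Num.sqrt (\sum_(i < n) x i 0 ^+ 2).

Definition spectral_norm m n (A : 'M[R]_(m, n)) : R :=
  sup [set norm2 (A *m x) | x in [set x : 'cV[R]_n | norm2 x <= 1]].

Lemma sumsq_mx n (v : 'rV[R]_n) : v *m v^T = (\sum_i v 0 i ^+ 2)%:M.
Proof.
apply/matrixP=> i j; rewrite !ord1 !mxE eqxx mulr1n.
by apply: eq_bigr => k _; rewrite mxE expr2.
Qed.

Lemma row_free_orthonormal r m (A : 'M[R]_(r, m)) : row_free A ->
  exists2 T : 'M[R]_(r, m), T *m T^T = 1%:M & (T == A)%MS.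
Proof.
elim: r A => [|r IH] A Afree.
  by exists A; [apply/matrixP=> -[] | rewrite submx_refl].
move: A Afree; rewrite -[r.+1]/(1 + r)%N => A.
rewrite -[A]vsubmxK; set a := usubmx A; set B := dsubmx A => Afree.
have Bfree : row_free B.
  rewrite -kermx_eq0; apply/eqP/row_matrixP => i; rewrite row0.
  have/(row_free_inj Afree) : row_mx (0 : 'rV_1) (row i (kermx B)) *m col_mx a B
      = 0 *m col_mx a B.
    by rewrite mul_row_col !mul0mx add0r -row_mul mulmx_ker row0.
  by rewrite -(row_mx0 _ 1 1 r) => /eq_row_mx[].
have [T TT /eqmxP eqTB] := IH B Bfree.
pose v := a - a *m T^T *m T.
have vT : v *m T^T = 0.
  by rewrite mulmxBl -[_ *m T *m T^T]mulmxA TT mulmx1 subrr.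
have v0 : v != 0.
  apply/eqP => /(congr1 (fun w => w + a *m T^T *m T)).
  rewrite subrK add0r => aE.
  have : (a <= B)%MS by rewrite -eqTB aE submxMl.
  case/submxP=> D aD.
  have/(row_free_inj Afree) : row_mx 1%:M (- D) *m col_mx a B = 0 *m col_mx a B.
    by rewrite mul_row_col mul1mx mulNmx -aD subrr mul0mx.
  rewrite -(row_mx0 _ 1 1 r) => /eq_row_mx[/matrixP/(_ 0 0)].
  by rewrite !mxE /= => /eqP; rewrite oner_eq0.
pose s := \sum_i v 0 i ^+ 2.
have s_gt0 : 0 < s.
  rewrite lt_def sumr_ge0 ?andbT; last by move=> i _; exact: sqr_ge0.
  apply: contra v0 => /eqP/psumr_eq0P v20.
  apply/eqP/matrixP=> i j; rewrite ord1 [RHS]mxE.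
  by apply/eqP; rewrite -sqrf_eq0 v20// => k _; exact: sqr_ge0.
pose t := (Num.sqrt s)^-1.
have t0 : t != 0 by rewrite invr_eq0 sqrtr_eq0 -ltNge.
exists (col_mx (t *: v) T).
  have Tv : T *m v^T = 0 by rewrite -[T *m v^T]trmxK trmx_mul trmxK vT trmx0.
  rewrite tr_col_mx mul_col_row TT linearZ /= -!scalemxAr -!scalemxAl vT Tv.
  rewrite !scaler0 sumsq_mx !scale_scalar_mx -/s mulrA -invfM -expr2.
  by rewrite sqr_sqrtr ?ltW// mulVf ?gt_eqF// -scalar_mx_block.
apply/andP; split; rewrite col_mx_sub; apply/andP; split.
- rewrite scalemx_sub// addmx_sub ?col_mx_sub//.
    by rewrite -addsmxE addsmxSl.
  rewrite eqmx_opp -mulmxA mulmx_sub// mulmx_sub// eqTB.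
  by rewrite -addsmxE addsmxSr.
- by rewrite eqTB -addsmxE addsmxSr.
- rewrite -[a](subrK (a *m T^T *m T)) -/v addmx_sub//.
    rewrite -addsmxE (submx_trans _ (addsmxSl _ _))//.
    by rewrite eqmx_scale.
  by rewrite mulmx_sub// -addsmxE addsmxSr.
- by rewrite -eqTB -addsmxE addsmxSr.
Qed.

Lemma orthonormal_basisP p m (L : 'M[R]_(p, m)) :
  orthonormal (orthonormal_basis L) /\ ((orthonormal_basis L)^T == L)%MS.
Proof.
apply: (@xgetPex _ 0 [set U | orthonormal U /\ (U^T == L)%MS]).
have [T TT /eqmxP TL] := row_free_orthonormal (row_base_free L).
exists T^T; rewrite /= /orthonormal trmxK; split=> //.
by apply/eqmxP; exact: eqmx_trans TL (eq_row_base L).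
Qed.

Lemma char_poly_orth n (A W : 'M[R]_n) : W^T *m W = 1%:M ->
  char_poly (W^T *m A *m W) = char_poly A.
Proof.
move=> WW.
have pW : map_mx polyC W^T *m map_mx polyC W = 1%:M.
  by rewrite -map_mxM WW map_mx1.
rewrite /char_poly /char_poly_mx !map_mxM.
have -> : 'X%:M - map_mx polyC W^T *m map_mx polyC A *m map_mx polyC W =
    map_mx polyC W^T *m ('X%:M - map_mx polyC A) *m map_mx polyC W.
  by rewrite mulmxBr mulmxBl scalar_mxC -[_%:M *m _ *m _]mulmxA pW mulmx1.
by rewrite !det_mulmx mulrAC -det_mulmx pW det1 mul1r.
Qed.

Lemma kappaE d m p r (S : 'M[R]_(d, m)) (L : 'M[R]_(p, m))
    (U : 'M[R]_(m, r)) :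
  orthonormal U -> (U^T == L)%MS -> kappa S L = cond (S *m U).
Proof.
move=> oU /eqmxP UL; have [] := orthonormal_basisP L.
rewrite /kappa; move: (orthonormal_basis L) => V oV /eqmxP VL.
have rE : \rank L = r.
  rewrite -UL; apply/eqP; rewrite -/(row_free _).
  by apply/row_freeP; exists U.
move: (\rank L) rE V oV VL => q rE; case: r / rE U oU UL => U oU UL V oV VL.
have /submxP[D] : (U^T <= V^T)%MS by rewrite UL VL.
move=> /(congr1 trmx); rewrite trmx_mul !trmxK => UE.
have DD : D *m D^T = 1%:M.
  by rewrite -oU UE trmx_mul trmxK -mulmxA (mulmxA V^T) oV mul1mx.
rewrite /cond.
suff -> : singular_values (S *m V) = singular_values (S *m U) by [].
rewrite /singular_values /eigenvalues UE.
have := @char_poly_orth _ ((S *m V)^T *m (S *m V)) D^T.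
rewrite trmxK => /(_ DD) <-.
by rewrite !trmx_mul trmxK !mulmxA.
Qed.

End SingularValues.

Section QRCP.
Variable R : realType.

Definition upper_trapezoidal m n (A : 'M[R]_(m, n)) : bool := is_trig_mx A^T.

(* The p by q submatrix of A with rows r0+1..r0+p and columns c0+1..c0+q (rows
   and columns numbered from 1), completed by 0 outside the bounds of A. *)
Definition slice (r0 c0 p q : nat) m n (A : 'M[R]_(m, n)) : 'M[R]_(p, q) :=
  \matrix_(i, j)
    match insub (r0 + i)%N : option 'I_m, insub (c0 + j)%N : option 'I_n with
    | Some i', Some j' => A i' j'
    | _, _ => 0
    end.

Definition blockA l k n (A : 'M[R]_(k, n)) : 'M[R]_(l, l) := slice 0 0 l l A.
Definition blockB l k n (A : 'M[R]_(k, n)) : 'M[R]_(l, n - l) :=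
  slice 0 l l (n - l) A.
Definition blockC l k n (A : 'M[R]_(k, n)) : 'M[R]_(k - l, n - l) :=
  slice l l (k - l) (n - l) A.

(* Only the factors Q_k and R_k are kept. The inner dimension k is a field,
   since it depends on the rank of the matrix being factored. *)
Record qrcp_output (m n : nat) := QRCPOutput {
  out_k : nat;
  out_Q : 'M[R]_(m, out_k);
  out_R : 'M[R]_(out_k, n);
  out_J : 'S_n
}.

(* col_perm J X is X[:, J]: its j-th column is column J j of X. *)
Definition is_QRCP m n (X : 'M[R]_(m, n)) (o : qrcp_output m n) : Prop :=
  [/\ out_k o = \rank X,
      orthonormal (out_Q o),
      upper_trapezoidal (out_R o) &
      col_perm (out_J o) X = out_Q o *m out_R o].

(* f_1..f_k and g_1..g_k are f 1..f k and g 1..g k; other values of f and g are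
   irrelevant. The bounds on the singular values of A_l make A_l invertible,
   as f_l >= 1 and the first k singular values of X are positive. *)
Definition strong_RRQR m n (qrcp : 'M[R]_(m, n) -> qrcp_output m n)
    (X : 'M[R]_(m, n)) (f g : nat -> R) : Prop :=
  let k := out_k (qrcp X) in
  let Rk := out_R (qrcp X) in
  [/\ (n <= m)%N,
      is_QRCP X (qrcp X) &
      forall l : nat, (1 <= l <= k)%N ->
      [/\ 1 <= f l,
          forall j, (1 <= j <= l)%N -> sigma j X / f l <= sigma j (blockA l Rk),
          forall j, (1 <= j <= k - l)%N ->
            sigma j (blockC l Rk) <= f l * sigma (l + j) X &
          spectral_norm (invmx (blockA l Rk) *m blockB l Rk) <= g l]].

(* The upper-triangular factor with positive diagonal; it exists, and is
   unique, when G is symmetric positive definite. *)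
Definition chol k (G : 'M[R]_k) : 'M[R]_k :=
  xget 0 [set T : 'M[R]_k | [/\ upper_trapezoidal T,
                                forall i, 0 < T i i & G = T^T *m T]].

Definition cqrrpt_core m n d (qrcp : 'M[R]_(d, n) -> qrcp_output d n)
    (S : 'M[R]_(d, m)) (M : 'M[R]_(m, n)) : qrcp_output m n :=
  let Msk := S *m M in
  let Rsk := out_R (qrcp Msk) in
  let J := out_J (qrcp Msk) in
  let k := \rank Rsk in
  let Mpre := slice 0 0 m k (col_perm J M) *m invmx (slice 0 0 k k Rsk) in
  let G := Mpre^T *m Mpre in
  let Rpre := chol G in
  let Qk := Mpre *m invmx Rpre in
  let Rk := Rpre *m slice 0 0 k n Rsk in
  QRCPOutput Qk Rk J.

End QRCP.

(* Main.v *)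
Require Import Defs.
From mathcomp Require Import all_boot all_order all_algebra all_fingroup.
From mathcomp Require Import polyrcf complex.
From mathcomp Require Import ring lra.
From mathcomp Require Import classical_sets reals ereal.
Set Implicit Arguments.
Unset Strict Implicit.
Unset Printing Implicit Defensive.
Import Order.TTheory GRing.Theory Num.Theory.
Local Open Scope ring_scope.

(** If S distorts norms on range(M) only by factors between s1 and s2, with
    c = s2 / s1, then S M and M have the same rank, and their singular values
    satisfy s1 sigma_j(M) <= sigma_j(S M) <= s2 sigma_j(M). Let A be the
    R-factor of the sketch S M, so that S M[:, J] = Q A. The preconditioned
    matrix Mpre satisfies S Mpre = Q; hence its Cholesky factor T, for which
    |T x| = |Mpre x|, satisfies s1 |T x| <= |x| <= s2 |T x|. Moreover
    M[:, J] = Mpre A, because the two sides lie in range(M), where S is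
    injective, and agree after multiplication by S. So T A is the R-factor
    of M.

    As T and A are upper trapezoidal, write T = [T1, T12; 0, T2]; the blocks
    of T A are T1 A_l, T1 B_l + T12 C_l and T2 C_l. The blocks of T inherit
    the bounds of T: T1 shrinks norms at most by the factor s2, while T12
    and T2 expand them at most by 1 / s1. Combined with the comparison of
    sigma_j(S M) and sigma_j(M), this costs one factor c in each of the two
    singular value bounds. For the third bound,
      (T1 A_l)^-1 (T1 B_l + T12 C_l) = A_l^-1 B_l + A_l^-1 T1^-1 T12 C_l,
    where the last term vanishes if l = k and otherwise has norm at most
      (f_l / sigma_l(S M)) s2 (1 / s1) (f_l sigma_(l+1)(S M)) <= c f_l^2.

    All comparisons of singular values of two matrices X and Y come from an
    inequality |X v| <= a |Y v| (sigma_monotone). Singular values are defined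
    here through the roots of the characteristic polynomial of X^T X, so the
    comparison rests on the real spectral theorem (symmetric_diagonalization)
    and on Weyl's monotonicity principle (eigenvalues_monotone). The block
    bounds are assembled in rrqr_bounds_transfer. *)

(** * Euclidean norm *)

Section Norm.
Variable R : realType.

Lemma sqr_norm2 n (v : 'cV[R]_n) : norm2 v ^+ 2 = (v^T *m v) 0 0.
Proof.
rewrite sqr_sqrtr ?sumr_ge0// => [|i _]; last exact: sqr_ge0.
by rewrite mxE; apply: eq_bigr => i _; rewrite mxE expr2.
Qed.

Lemma norm2_ge0 n (v : 'cV[R]_n) : 0 <= norm2 v.
Proof. exact: sqrtr_ge0. Qed.

Lemma norm2_eq0 n (v : 'cV[R]_n) : (norm2 v == 0) = (v == 0).
Proof.
apply/idP/eqP => [|->]; last first.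
  by rewrite -sqrf_eq0 sqr_norm2 mulmx0 mxE.
rewrite -sqrf_eq0 sqr_norm2 mxE => v0; apply/colP => i; rewrite [RHS]mxE.
move: v0; under eq_bigr do rewrite mxE -expr2; rewrite psumr_eq0.
  by move=> /allP/(_ i); rewrite mem_index_enum sqrf_eq0 => /(_ isT)/eqP.
by move=> j _; exact: sqr_ge0.
Qed.

Lemma norm20 n : norm2 (0 : 'cV[R]_n) = 0.
Proof. by apply/eqP; rewrite norm2_eq0. Qed.

Lemma norm2_le n p (u : 'cV[R]_n) (v : 'cV[R]_p) :
  (norm2 u <= norm2 v) = ((u^T *m u) 0 0 <= (v^T *m v) 0 0).
Proof. by rewrite -!sqr_norm2 ler_sqr ?nnegrE ?norm2_ge0. Qed.

Lemma norm2_eq n p (u : 'cV[R]_n) (v : 'cV[R]_p) :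
  u^T *m u = v^T *m v -> norm2 u = norm2 v.
Proof. by move=> uv; apply/le_anti; rewrite !norm2_le uv lexx. Qed.

Lemma norm2_isometry n p (U : 'M[R]_(n, p)) v :
  U^T *m U = 1%:M -> norm2 (U *m v) = norm2 v.
Proof.
by move=> UU; apply: norm2_eq; rewrite trmx_mul -mulmxA (mulmxA U^T) UU mul1mx.
Qed.

Lemma norm2Z n (a : R) (v : 'cV[R]_n) : norm2 (a *: v) = `|a| * norm2 v.
Proof.
apply/eqP; rewrite -(@eqrXn2 _ 2%N) ?mulr_ge0 ?norm2_ge0// exprMn !sqr_norm2.
rewrite [(_ *: _)^T]linearZ /= -scalemxAl -scalemxAr scalerA -expr2 mxE.
by rewrite real_normK ?num_real.
Qed.

(** The squared norm of |v|^2 u - (u . v) v is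
    |v|^2 (|u|^2 |v|^2 - (u . v)^2). *)
Lemma CauchySchwarz n (u v : 'cV[R]_n) :
  (u^T *m v) 0 0 <= norm2 u * norm2 v.
Proof.
have [->|v0] := eqVneq v 0; first by rewrite mulmx0 norm20 mulr0 mxE.
have v_gt0 : 0 < norm2 v by rewrite lt_def norm2_eq0 v0 norm2_ge0.
apply: le_trans (ler_norm _) _.
rewrite -ler_sqr ?nnegrE ?mulr_ge0 ?norm2_ge0// exprMn real_normK ?num_real//.
have tE (x y : 'cV[R]_n) : (x^T *m y) 0 0 = (y^T *m x) 0 0.
  by rewrite -[x^T *m y]trmxK trmx_mul trmxK mxE.
set b := (u^T *m v) 0 0; set w := norm2 v ^+ 2 *: u - b *: v.
have : 0 <= norm2 w ^+ 2 by exact: sqr_ge0.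
have -> : norm2 w ^+ 2 = norm2 v ^+ 2 * (norm2 u ^+ 2 * norm2 v ^+ 2 - b ^+ 2).
  rewrite [LHS]sqr_norm2 /w [(_ - _)^T]linearB /= ![(_ *: _)^T]linearZ /=.
  rewrite !mulmxBl !mulmxBr -!scalemxAl -!scalemxAr.
  have E (X Y : 'M[R]_1) : (X - Y) 0 0 = X 0 0 - Y 0 0 by rewrite !mxE.
  have F a (X : 'M[R]_1) : (a *: X) 0 0 = a * X 0 0 by rewrite mxE.
  rewrite !E !F -!sqr_norm2 -/b (tE v u) -/b.
  by ring.
by rewrite pmulr_rge0 ?exprn_gt0// subr_ge0.
Qed.

Lemma norm2D n (u v : 'cV[R]_n) : norm2 (u + v) <= norm2 u + norm2 v.
Proof.
rewrite -ler_sqr ?nnegrE ?addr_ge0 ?norm2_ge0// sqrrD !sqr_norm2.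
rewrite [(_ + _)^T]linearD /= mulmxDl !mulmxDr.
have E (X Y : 'M[R]_1) : (X + Y) 0 0 = X 0 0 + Y 0 0 by rewrite mxE.
rewrite !E -!sqr_norm2.
have := CauchySchwarz u v; have := CauchySchwarz v u.
by lra.
Qed.

(** The square of |U^T y| is the inner product of y with U U^T y, and
    |U U^T y| = |U^T y|. *)
Lemma norm2_trmx_le n p (U : 'M[R]_(n, p)) (y : 'cV_n) :
  U^T *m U = 1%:M -> norm2 (U^T *m y) <= norm2 y.
Proof.
move=> UU; have [->|y0] := eqVneq (norm2 (U^T *m y)) 0; first exact: norm2_ge0.
have y_gt0 : 0 < norm2 (U^T *m y) by rewrite lt_def y0 norm2_ge0.
rewrite -(ler_pM2r y_gt0) -expr2 sqr_norm2 trmx_mul trmxK -mulmxA.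
by apply: le_trans (CauchySchwarz _ _) _; rewrite norm2_isometry.
Qed.

End Norm.

(** * Invertible matrices *)

Lemma inj_unitmx (R : fieldType) n (A : 'M[R]_n) :
  (forall v : 'cV_n, A *m v = 0 -> v = 0) -> A \in unitmx.
Proof.
move=> Ainj; rewrite unitmxE unitfE; apply/negP => /eqP detA0.
have /det0P[v v0 vA] : \det A^T == 0 by rewrite det_tr detA0.
case/eqP: v0; apply: trmx_inj; rewrite trmx0; apply: Ainj.
by rewrite -[LHS]trmxK trmx_mul trmxK vA trmx0.
Qed.

Lemma invmxM (R : fieldType) n (A B : 'M[R]_n) : A \in unitmx -> B \in unitmx ->
  invmx (A *m B) = invmx B *m invmx A.
Proof.
move=> uA uB; have uAB : A *m B \in unitmx by rewrite unitmx_mul uA.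
by apply: (can_inj (mulmxK uAB)); rewrite mulVmx// mulmxA mulmxKV// mulVmx.
Qed.

(** * Spectral theorem for real symmetric matrices *)

Section SpectralTheorem.
Variable R : realType.

(** Over the complex numbers A has an eigenvalue, and it is real because A is
    Hermitian; the real matrix A then also has an eigenvector for it. *)
Lemma symmetric_eigenvector n (A : 'M[R]_n) : (0 < n)%N -> A^T = A ->
  exists a, exists2 v : 'rV_n, v != 0 & v *m A = a *: v.
Proof.
move=> n_gt0 At.
pose AC : 'M[R[i]]_n := map_mx (@real_complex R) A.
have [z /eigenvalueP[w wA w0]] := spectral.eigenvalue_closed AC n_gt0.
have ACc : map_mx Num.conj AC = AC.
  apply/matrixP => i j; rewrite !mxE; apply/eqP.
  by rewrite eq_complex /= oppr0 !eqxx.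
have ACt : AC^T = AC by rewrite /AC map_trmx At.
(* Compare w A w^* = z |w|^2 with its conjugate: both w A w^* and |w|^2 are
   real, and |w|^2 is not 0. *)
have zr : z^* = z.
  pose wc := map_mx Num.conj w.
  have wcc : map_mx Num.conj wc = w by apply/rowP => i; rewrite !mxE conjCK.
  have wwE : (w *m wc^T) 0 0 = \sum_i `|w 0 i| ^+ 2.
    by rewrite mxE; apply: eq_bigr => i _; rewrite !mxE normCK.
  have ww_gt0 : 0 < (w *m wc^T) 0 0.
    rewrite wwE lt_def sumr_ge0 ?andbT => [|i _]; last exact: exprn_ge0.
    apply: contra w0 => /eqP/psumr_eq0P w20; apply/eqP/rowP => i; rewrite mxE.
    by apply/eqP; rewrite -normr_eq0 -sqrf_eq0 w20// => j _; exact: exprn_ge0.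
  have wwr : ((w *m wc^T) 0 0)^* = (w *m wc^T) 0 0.
    by apply: conj_Creal; exact: gtr0_real.
  have E : (w *m AC *m wc^T) 0 0 = z * (w *m wc^T) 0 0.
    by rewrite wA -scalemxAl mxE.
  have wAwr : ((w *m AC *m wc^T) 0 0)^* = (w *m AC *m wc^T) 0 0.
    have -> : ((w *m AC *m wc^T) 0 0)^* = map_mx Num.conj (w *m AC *m wc^T) 0 0.
      by rewrite [RHS]mxE.
    rewrite !map_mxM -map_trmx ACc wcc.
    have -> : wc *m AC *m w^T = (w *m AC *m wc^T)^T.
      by rewrite !trmx_mul trmxK ACt mulmxA.
    by rewrite mxE.
  apply: (mulIf (lt0r_neq0 ww_gt0)); rewrite -[in LHS]wwr -rmorphM -E.
  exact: wAwr.
have [a za] : exists a, z = a%:C%C.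
  move: zr; case: (z) => x y /eqP; rewrite eq_complex /= => /andP[_ /eqP yN].
  by exists x; congr (_ +i* _)%C; lra.
have : eigenvalue A a.
  have : eigenvalue AC z by apply/eigenvalueP; exists w.
  by rewrite !eigenvalue_root_char za /AC -map_char_poly fmorph_root.
by move=> /eigenvalueP[v vA v0]; exists a; exists v.
Qed.

(** Induction on the size: the orthogonal complement of an eigenvector is
    invariant under A, and A is compressed to it. *)
Lemma symmetric_orth_diag n (A : 'M[R]_n) : A^T = A ->
  exists2 P : 'M[R]_n, P *m P^T = 1%:M & exists d, P *m A *m P^T = diag_mx d.
Proof.
elim: n A => [A _|n IH].
  by exists 1%:M; [rewrite trmx1 mulmx1 | exists 0; apply/matrixP => -[]].
rewrite -[n.+1]/(1 + n)%N => A At.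
have [a [v v0 vA]] := symmetric_eigenvector (ltn0Sn n) At.
have [u uA uu] : exists2 u : 'rV_(1 + n), u *m A = a *: u & u *m u^T = 1%:M.
  have v_gt0 : 0 < norm2 v^T.
    by rewrite lt_def norm2_ge0 norm2_eq0 -trmx0 (inj_eq trmx_inj) v0.
  exists ((norm2 v^T)^-1 *: v); first by rewrite -scalemxAl vA !scalerA mulrC.
  apply/matrixP => i j; rewrite !ord1 -{1}[_ *: v]trmxK -sqr_norm2.
  rewrite linearZ /= norm2Z normfV ger0_norm ?norm2_ge0// mulVf ?gt_eqF//.
  by rewrite expr1n mxE.
have rk : \rank (kermx u^T) = n.
  rewrite mxrank_ker mxrank_tr.
  have -> : \rank u = 1%N.
    by apply/eqP; rewrite -/(row_free _); apply/row_freeP; exists u^T.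
  by rewrite subn1.
(* The rows of T form an orthonormal basis of the complement of u. *)
have [T TT /eqmxP TE] := row_free_orthonormal (row_base_free (kermx u^T)).
move: T TT TE; move: (row_base _) (eq_row_base (kermx u^T)) => K; move: K.
rewrite rk => K KE T TT TE.
have Tu : T *m u^T = 0.
  by apply: sub_kermxP; rewrite -KE -TE submx_refl.
have uT : u *m T^T = 0 by rewrite -[LHS]trmxK trmx_mul trmxK Tu trmx0.
have TAt : (T *m A *m T^T)^T = T *m A *m T^T.
  by rewrite !trmx_mul trmxK At mulmxA.
have [P PP [d dE]] := IH _ TAt.
exists (col_mx u (P *m T)).
  rewrite tr_col_mx mul_col_row uu trmx_mul !mulmxA uT mul0mx.
  rewrite -[P *m T *m _]mulmxA Tu.
  by rewrite -[P *m T *m _]mulmxA TT mulmx0 mulmx1 PP -scalar_mx_block.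
exists (row_mx (const_mx a) d).
have Au : A *m u^T = a *: u^T.
  by rewrite -[LHS]trmxK trmx_mul trmxK At uA linearZ.
rewrite tr_col_mx mul_col_mx mul_col_row uA -!scalemxAl uu trmx_mul mulmxA uT.
rewrite mul0mx scaler0 -!mulmxA Au -scalemxAr -scalemxAr Tu !mulmx0 scaler0.
rewrite !mulmxA in dE *; rewrite dE.
by rewrite (@diag_mx_row _ n 1) diag_const_mx scale_scalar_mx mulr1.
Qed.

Lemma eigenvalues_perm n (A : 'M[R]_n) (s : seq R) :
  char_poly A = \prod_(x <- s) ('X - x%:P) -> perm_eq (eigenvalues A) s.
Proof.
move=> AE; rewrite /eigenvalues perm_sort; apply/allP => x _ /=; apply/eqP.
have p0 : \prod_(y <- s) ('X - y%:P) != 0 :> {poly R}.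
  by rewrite monic_neq0 ?monic_prod_XsubC.
have mupE t : mup x (\prod_(y <- t) ('X - y%:P)) = count_mem x t.
  elim: t => [|y t IH]; first by rewrite big_nil mupNroot// root1.
  rewrite big_cons mupM ?monic_neq0 ?monicXsubC ?monic_prod_XsubC// IH.
  by rewrite -['X - _]expr1 mup_XsubCX /=; case: eqP.
rewrite AE -[in RHS]mupE; set p := \prod_(_ <- _) _ in p0 *.
have cE r : uniq r ->
    count_mem x (flatten [seq nseq (mup y p) y | y <- r]) =
    (mup x p * (x \in r))%N.
  elim: r => [|y r IH] /=; first by rewrite muln0.
  case/andP => yr r_uniq; rewrite count_cat count_nseq IH//= in_cons.
  have [<-|] := eqVneq y x; last by [].
  by rewrite (negPf yr) muln0 muln1 mul1n addn0.
rewrite cE; last exact: sorted_uniq lt_trans ltxx _ (sorted_roots _ _ _).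
have -> : (x \in rootsR p) = root p x by rewrite -(roots_on_rootsR p0) inE.
by case: (boolP (root p x)) => [|/mupNroot->]; rewrite (muln1, mul0n).
Qed.

(** Any orthogonal diagonalization determines the characteristic polynomial,
    hence the sorted list of eigenvalues up to a permutation; permuting the
    eigenbasis puts the diagonal in sorted order. *)
Lemma symmetric_diagonalization n (A : 'M[R]_n) : A^T = A ->
  size (eigenvalues A) = n /\
  exists2 P : 'M[R]_n, P *m P^T = 1%:M &
    P *m A *m P^T = diag_mx (\row_i nth 0 (eigenvalues A) i).
Proof.
move=> At; have [P PP [d dE]] := symmetric_orth_diag At.
have eE : perm_eq (eigenvalues A) [tuple d 0 i | i < n].
  apply: eigenvalues_perm; rewrite big_tuple.
  have PtP : P^T^T *m P^T = 1%:M by rewrite trmxK.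
  have := char_poly_orth A PtP; rewrite trmxK dE => <-.
  rewrite char_poly_trig ?diag_mx_is_trig//.
  by apply: eq_bigr => i _; rewrite tnth_mktuple !mxE eqxx.
have sz : size (eigenvalues A) = n by rewrite (perm_size eE) size_tuple.
split=> //.
have /tuple_permP[s sE] :
  perm_eq (Tuple (introT eqP sz)) [tuple d 0 i | i < n] by [].
exists (row_perm s P).
  rewrite row_permE trmx_mul tr_perm_mx mulmxA -(mulmxA _ P) PP mulmx1.
  by rewrite -perm_mxM mulgV perm_mx1.
rewrite row_permE trmx_mul tr_perm_mx -!mulmxA (mulmxA A) 2!(mulmxA P) dE.
rewrite mulmxA -row_permE -col_permE.
apply/matrixP => i j; rewrite !mxE (inj_eq perm_inj); congr (_ *+ _).
rewrite -[nth 0 _ _](tnth_nth 0 (Tuple (introT eqP sz))) (val_inj sE).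
by rewrite !tnth_mktuple.
Qed.

Lemma eigenvalues_sorted n (A : 'M[R]_n) i j : A^T = A ->
  (i <= j < n)%N -> nth 0 (eigenvalues A) j <= nth 0 (eigenvalues A) i.
Proof.
move=> At /andP[ij jn]; have [sz _] := symmetric_diagonalization At.
have : sorted >=%R (eigenvalues A).
  by apply: sort_sorted => x y; exact: le_total.
have ge_trans : transitive (>=%R : rel R).
  by move=> y x z xy yz; exact: le_trans yz xy.
move=> /(sorted_leq_nth ge_trans (@lexx _ _)); apply=> //; rewrite inE sz//.
exact: leq_ltn_trans jn.
Qed.

Lemma quadratic_form_diag n (A P : 'M[R]_n) (d : 'rV_n) (v : 'cV_n) :
  P *m P^T = 1%:M -> P *m A *m P^T = diag_mx d ->
  (v^T *m A *m v) 0 0 = \sum_i d 0 i * (P *m v) i 0 ^+ 2.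
Proof.
move=> PP dE; have PtP : P^T *m P = 1%:M by exact: mulmx1C.
have -> : v^T *m A *m v = (P *m v)^T *m diag_mx d *m (P *m v).
  rewrite -dE trmx_mul !mulmxA -(mulmxA v^T P^T) PtP mulmx1.
  by rewrite -(mulmxA _ P^T P) PtP mulmx1.
rewrite mxE; apply: eq_bigr => i _; rewrite mul_mx_diag !mxE.
by ring.
Qed.

End SpectralTheorem.

(** * Singular values and norms *)

Section SingularValueBounds.
Variable R : realType.

Lemma sumsq_orth n (P : 'M[R]_n) (v : 'cV_n) : P *m P^T = 1%:M ->
  \sum_i (P *m v) i 0 ^+ 2 = (v^T *m v) 0 0.
Proof.
move=> /mulmx1C PP.
rewrite -sqr_norm2 -(norm2_isometry v PP) sqr_sqrtr ?sumr_ge0// => i _.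
exact: sqr_ge0.
Qed.

(** Weyl's monotonicity principle. Some v <> 0 is orthogonal to the
    eigenvectors of B of index < j and to those of A of index > j, since these
    are only n - 1 conditions; on v the form of A is at least its j-th
    eigenvalue times |v|^2, and that of B at most the j-th eigenvalue of B
    times |v|^2. *)
Lemma eigenvalues_monotone n (A B : 'M[R]_n) (b : R) j :
  A^T = A -> B^T = B -> 0 <= b ->
  (forall v : 'cV_n, (v^T *m A *m v) 0 0 <= b * (v^T *m B *m v) 0 0) ->
  (j < n)%N -> nth 0 (eigenvalues A) j <= b * nth 0 (eigenvalues B) j.
Proof.
move=> At Bt b0 AB jn.
have [_ [P PP PA]] := symmetric_diagonalization At.
have [_ [Q QQ QB]] := symmetric_diagonalization Bt.
(* The n - 1 orthogonality conditions, with a zero row of index j to make the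
   system square. *)
pose K : 'M[R]_n := \matrix_(i, a)
  if (i < j)%N then Q i a else if (i == j :> nat) then 0 else P i a.
have K0 : \det K == 0.
  apply/det0P; exists (delta_mx 0 (Ordinal jn)).
    apply/eqP => /rowP/(_ (Ordinal jn)); rewrite !mxE !eqxx => /eqP.
    by rewrite oner_eq0.
  by apply/rowP => a; rewrite -rowE !mxE /= ltnn eqxx.
have /det0P[w w0 wK] : \det K^T == 0 by rewrite det_tr.
pose v := w^T; have Kv : K *m v = 0.
  by rewrite -[LHS]trmxK trmx_mul trmxK wK trmx0.
have vv_gt0 : 0 < (v^T *m v) 0 0.
  rewrite -sqr_norm2 exprn_gt0// lt_def norm2_ge0 norm2_eq0.
  by rewrite -trmx0 (inj_eq trmx_inj) w0.
have Qv (i : 'I_n) : (i < j)%N -> (Q *m v) i 0 = 0.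
  move=> ij; have := congr1 (fun x : 'cV_n => x i 0) Kv; rewrite [RHS]mxE => <-.
  by rewrite !mxE; apply: eq_bigr => a _; rewrite !mxE ij.
have Pv (i : 'I_n) : (j < i)%N -> (P *m v) i 0 = 0.
  move=> ij; have := congr1 (fun x : 'cV_n => x i 0) Kv; rewrite [RHS]mxE => <-.
  rewrite !mxE; apply: eq_bigr => a _; rewrite !mxE ltnNge ltnW//=.
  by rewrite gtn_eqF.
rewrite -(ler_pM2r vv_gt0) -mulrA.
have lA : nth 0 (eigenvalues A) j * (v^T *m v) 0 0 <= (v^T *m A *m v) 0 0.
  rewrite (quadratic_form_diag v PP PA) -(sumsq_orth v PP) mulr_sumr.
  apply: ler_sum => i _; rewrite [X in _ <= X * _]mxE.
  have [/Pv ->|/= ij] := ltnP j i; first by rewrite expr0n !mulr0.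
  apply: ler_wpM2r; first exact: sqr_ge0.
  by apply: eigenvalues_sorted; rewrite // ij jn.
have lB : (v^T *m B *m v) 0 0 <= nth 0 (eigenvalues B) j * (v^T *m v) 0 0.
  rewrite (quadratic_form_diag v QQ QB) -(sumsq_orth v QQ) mulr_sumr.
  apply: ler_sum => i _; rewrite [X in X * _ <= _]mxE.
  have [/Qv ->|ij] := ltnP i j; first by rewrite expr0n !mulr0.
  apply: ler_wpM2r; first exact: sqr_ge0.
  by apply: eigenvalues_sorted; rewrite // ij ltn_ord.
exact: le_trans lA (le_trans (AB v) (ler_wpM2l b0 lB)).
Qed.

Lemma gram_sym m n (X : 'M[R]_(m, n)) : (X^T *m X)^T = X^T *m X.
Proof. by rewrite trmx_mul trmxK. Qed.

Lemma gram_form m n (X : 'M[R]_(m, n)) (v : 'cV_n) :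
  (v^T *m (X^T *m X) *m v) 0 0 = norm2 (X *m v) ^+ 2.
Proof. by rewrite sqr_norm2 trmx_mul !mulmxA. Qed.

Lemma sigmaE j m n (X : 'M[R]_(m, n)) : sigma j X =
  if (j.-1 < minn m n)%N then Num.sqrt (nth 0 (eigenvalues (X^T *m X)) j.-1)
  else 0.
Proof.
have [sz _] := symmetric_diagonalization (gram_sym X).
rewrite /sigma /singular_values; case: ltnP => [jmn|mnj].
  by rewrite nth_take// (nth_map 0)// sz (leq_trans jmn)// geq_minr.
by rewrite nth_default// (leq_trans _ mnj)// size_take_min geq_minl.
Qed.

Lemma gram_eigenvalue_ge0 m n (X : 'M[R]_(m, n)) j :
  0 <= nth 0 (eigenvalues (X^T *m X)) j.
Proof.
have [sz [P PP PE]] := symmetric_diagonalization (gram_sym X).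
have [jn|nj] := ltnP j n; last by rewrite nth_default ?sz.
have := quadratic_form_diag (P^T *m delta_mx (Ordinal jn) 0) PP PE.
rewrite gram_form (mulmxA P) PP mul1mx (bigD1 (Ordinal jn))//= big1 => [|i ij].
  by rewrite !mxE !eqxx expr1n mulr1 addr0 => <-; exact: sqr_ge0.
by rewrite !mxE (negPf ij) expr0n mulr0.
Qed.

Lemma sigma_ge0 j m n (X : 'M[R]_(m, n)) : 0 <= sigma j X.
Proof. by rewrite sigmaE; case: ifP => // _; exact: sqrtr_ge0. Qed.

Lemma sigma_antitone i j m n (X : 'M[R]_(m, n)) :
  (i <= j)%N -> sigma j X <= sigma i X.
Proof.
move=> ij; have ij1 : (i.-1 <= j.-1)%N by rewrite -!subn1 leq_sub2r.
rewrite 2!sigmaE; case: ltnP => [jmn|_]; last first.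
  by case: ifP => // _; exact: sqrtr_ge0.
rewrite (leq_ltn_trans ij1 jmn) ler_sqrt ?gram_eigenvalue_ge0//.
apply: eigenvalues_sorted; first exact: gram_sym.
by rewrite ij1 (leq_trans jmn)// geq_minr.
Qed.

(** The quadratic forms of X^T X and a^2 Y^T Y are compared. As both matrices
    have equally many singular values, the conventional value 0 past the last
    one is taken on both sides at once. *)
Lemma sigma_monotone m p n (X : 'M[R]_(m, n)) (Y : 'M[R]_(p, n)) (a : R) j :
  minn m n = minn p n -> 0 <= a ->
  (forall v, norm2 (X *m v) <= a * norm2 (Y *m v)) ->
  sigma j X <= a * sigma j Y.
Proof.
move=> mpn a0 XY; rewrite 2!sigmaE mpn.
case: ltnP => [jn|_]; last by rewrite mulr0.
rewrite -{1}(ger0_norm a0) -sqrtr_sqr -sqrtrM ?sqr_ge0// ler_sqrt; last first.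
  by rewrite mulr_ge0 ?sqr_ge0 ?gram_eigenvalue_ge0.
apply: eigenvalues_monotone; rewrite ?gram_sym ?sqr_ge0//; last first.
  by rewrite (leq_trans jn)// geq_minr.
by move=> v; rewrite !gram_form -exprMn ler_sqr ?nnegrE ?mulr_ge0 ?norm2_ge0.
Qed.

Lemma norm2_le_sigma1 m n (X : 'M[R]_(m, n)) (v : 'cV_n) :
  norm2 (X *m v) <= sigma 1 X * norm2 v.
Proof.
have [m0|m_gt0] := posnP m.
  have -> : X *m v = 0 by apply/colP => i; have := ltn_ord i; rewrite {2}m0.
  by rewrite norm20 mulr_ge0 ?sigma_ge0 ?norm2_ge0.
have [n0|n_gt0] := posnP n.
  have -> : v = 0 by apply/colP => i; have := ltn_ord i; rewrite {2}n0.
  by rewrite mulmx0 !norm20 mulr0.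
rewrite -ler_sqr ?nnegrE ?mulr_ge0 ?sigma_ge0 ?norm2_ge0// exprMn.
rewrite sigmaE leq_min m_gt0 n_gt0 /=.
rewrite [X in _ <= X * _]sqr_sqrtr ?gram_eigenvalue_ge0// -gram_form.
have [_ [P PP PE]] := symmetric_diagonalization (gram_sym X).
rewrite (quadratic_form_diag v PP PE) sqr_norm2 -(sumsq_orth v PP) mulr_sumr.
apply: ler_sum => i _; rewrite !mxE; apply: ler_wpM2r; first exact: sqr_ge0.
by apply: eigenvalues_sorted; [exact: gram_sym | exact: ltn_ord].
Qed.

Lemma sigman_le_norm2 m n (X : 'M[R]_(m, n)) (v : 'cV_n) : (n <= m)%N ->
  sigma n X * norm2 v <= norm2 (X *m v).
Proof.
move=> nm; have [n0|n_gt0] := posnP n.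
  have -> : v = 0 by apply/colP => i; have := ltn_ord i; rewrite {2}n0.
  by rewrite mulmx0 !norm20 mulr0.
rewrite -ler_sqr ?nnegrE ?mulr_ge0 ?sigma_ge0 ?norm2_ge0// exprMn.
rewrite sigmaE (minn_idPr nm) prednK// leqnn /=.
rewrite [X in X * _ <= _]sqr_sqrtr ?gram_eigenvalue_ge0// -gram_form.
have [_ [P PP PE]] := symmetric_diagonalization (gram_sym X).
rewrite (quadratic_form_diag v PP PE) sqr_norm2 -(sumsq_orth v PP) mulr_sumr.
apply: ler_sum => i _; rewrite !mxE; apply: ler_wpM2r; first exact: sqr_ge0.
apply: eigenvalues_sorted; first exact: gram_sym.
by rewrite -ltnS prednK// ltn_ord /=.
Qed.

(** In an eigenbasis of X^T X, the columns of X with zero eigenvalue vanish, so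
    the rank of X is at most the number of nonzero eigenvalues. *)
Lemma sigma_gt0 j m n (X : 'M[R]_(m, n)) :
  (1 <= j <= \rank X)%N -> 0 < sigma j X.
Proof.
case: j => // j; rewrite lt_def sigma_ge0 andbT => /= jX.
apply: contraL jX => s0; rewrite -leqNgt.
have [mnj|jmn] := leqP (minn m n) j.
  by rewrite (leq_trans _ mnj)// leq_min rank_leq_row rank_leq_col.
have jn : (j < n)%N by rewrite (leq_trans jmn)// geq_minr.
move: s0; rewrite sigmaE /= jmn sqrtr_eq0 => s0.
have [_ [P PP PE]] := symmetric_diagonalization (gram_sym X).
have /mulmx1C PtP := PP.
have XE : X = X *m P^T *m pid_mx j *m P.
  rewrite -[LHS]mulmx1 -PtP mulmxA; congr (_ *m P).
  apply/matrixP => a i; rewrite [RHS]mxE (bigD1 i)//=.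
  rewrite big1 ?addr0 => [|k ki]; last first.
    by rewrite [pid_mx _ _ _]mxE val_eqE (negPf ki) mulr0.
  rewrite [pid_mx _ _ _]mxE eqxx /=.
  have [ij|ji] := ltnP i j; first by rewrite mulr1.
  rewrite mulr0; have : norm2 (X *m (P^T *m delta_mx i 0)) == 0.
    rewrite -sqrf_eq0 -gram_form (quadratic_form_diag _ PP PE).
    rewrite (mulmxA P) PP mul1mx (bigD1 i)//=.
    rewrite big1 ?addr0 => [|k ki]; last first.
      by rewrite !mxE (negPf ki) expr0n mulr0.
    rewrite !mxE !eqxx expr1n mulr1 eq_le gram_eigenvalue_ge0 andbT.
    apply: le_trans s0; apply: eigenvalues_sorted; first exact: gram_sym.
    by rewrite ji ltn_ord.
  by rewrite norm2_eq0 mulmxA -colE => /eqP/colP/(_ a); rewrite !mxE.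
rewrite XE (leq_trans (mxrankM_maxl _ _))// (leq_trans (mxrankM_maxr _ _))//.
by rewrite rank_pid_mx// ltnW.
Qed.

End SingularValueBounds.

(** * Spectral norm *)

Section SpectralNorm.
Variable R : realType.
Local Open Scope classical_set_scope.

Lemma spectral_norm_has_sup m n (A : 'M[R]_(m, n)) :
  has_sup [set norm2 (A *m x) | x in [set x : 'cV[R]_n | norm2 x <= 1]].
Proof.
split; first by exists (norm2 (A *m 0)); exists 0; rewrite //= norm20.
exists (sigma 1 A) => _ [x /= x1 <-]; apply: le_trans (norm2_le_sigma1 A x) _.
by rewrite ler_piMr ?sigma_ge0.
Qed.

Lemma spectral_norm_ge0 m n (A : 'M[R]_(m, n)) : 0 <= spectral_norm A.
Proof.
apply: ub_le_sup; first by have [] := spectral_norm_has_sup A.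
by exists 0; rewrite /= ?norm20// mulmx0 norm20.
Qed.

Lemma norm2_le_spectral m n (A : 'M[R]_(m, n)) (x : 'cV_n) :
  norm2 (A *m x) <= spectral_norm A * norm2 x.
Proof.
have [->|x0] := eqVneq x 0; first by rewrite mulmx0 !norm20 mulr0.
have x_gt0 : 0 < norm2 x by rewrite lt_def norm2_eq0 x0 norm2_ge0.
rewrite -ler_pdivrMr// mulrC.
have -> : (norm2 x)^-1 * norm2 (A *m x) = norm2 (A *m ((norm2 x)^-1 *: x)).
  by rewrite -scalemxAr norm2Z normfV (ger0_norm (norm2_ge0 x)).
apply: ub_le_sup; first by have [] := spectral_norm_has_sup A.
exists ((norm2 x)^-1 *: x) => //=.
by rewrite norm2Z normfV (ger0_norm (norm2_ge0 x)) mulVf// gt_eqF.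
Qed.

Lemma spectral_norm_le m n (A : 'M[R]_(m, n)) a : 0 <= a ->
  (forall x, norm2 (A *m x) <= a * norm2 x) -> spectral_norm A <= a.
Proof.
move=> a0 Aa; apply: ge_sup; first by have [] := spectral_norm_has_sup A.
by move=> _ [x /= x1 <-]; apply: le_trans (Aa x) _; rewrite ler_piMr.
Qed.

End SpectralNorm.

(** * Cholesky factorization *)

Section Cholesky.
Variable R : realType.

(** Induction on the size: the rows of the factor below the first one come from
    the Schur complement of the first diagonal entry, which is again positive
    definite. *)
Lemma cholesky_exists n (G : 'M[R]_n) : G^T = G ->
  (forall v : 'cV_n, v != 0 -> 0 < (v^T *m G *m v) 0 0) ->
  exists T : 'M[R]_n, [/\ upper_trapezoidal T,
    forall i, 0 < T i i & G = T^T *m T].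
Proof.
elim: n G => [|n IH].
  move=> G _ _; exists 0; split; [|by case|by apply/matrixP => -[]].
  by apply/is_trig_mxP => -[].
rewrite -[n.+1]/(1 + n)%N => G Gt Gpos.
have [a [b [D [GE Dt]]]] : exists a b D, G = block_mx a%:M b b^T D /\ D^T = D.
  exists (ulsubmx G 0 0), (ursubmx G), (drsubmx G).
  by rewrite trmx_ursub trmx_drsub Gt -mx11_scalar submxK.
have a_gt0 : 0 < a.
  have := Gpos (col_mx 1%:M 0); rewrite GE tr_col_mx trmx0 trmx1.
  rewrite mul_row_block mul_row_col !mul0mx !mulmx0 !mul1mx mulmx1 !addr0.
  rewrite mxE eqxx; apply.
  by rewrite col_mx_eq0 oner_eq0.
pose s := Num.sqrt a; have s_gt0 : 0 < s by rewrite sqrtr_gt0.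
have ss : s * s = a by rewrite -expr2 sqr_sqrtr// ltW.
have sV : s * s^-1 = 1 by rewrite mulfV// gt_eqF.
have [||T [Tu Tp TE]] := IH (D - a^-1 *: (b^T *m b)).
- by rewrite linearB /= Dt linearZ /= trmx_mul trmxK.
- move=> w w0.
  (* For a given w, this first coordinate minimizes the form of G. *)
  have := Gpos (col_mx (- a^-1 *: (b *m w)) w).
  rewrite col_mx_eq0 negb_and w0 orbT => /(_ isT).
  congr (_ < _); congr (fun_of_matrix _ 0 0).
  rewrite GE tr_col_mx mul_row_block mul_row_col [(_ *: _)^T]linearZ /=.
  rewrite trmx_mul mul_mx_scalar scalerA mulrN mulfV ?gt_eqF//.
  rewrite scaleN1r addNr mul0mx add0r.
  rewrite mulmxBr mulmxBl mulmxDl addrC -!scalemxAl -!scalemxAr -!scalemxAl.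
  by rewrite !mulmxA scaleNr.
exists (block_mx s%:M (s^-1 *: b) 0 T); split.
- rewrite /upper_trapezoidal tr_block_mx trmx0 tr_scalar_mx.
  rewrite is_trig_block_mx// eqxx /=.
  by rewrite scalar_mx_is_trig.
- move=> i; case: (split_ordP i) => j ->.
    by rewrite block_mxEul ord1 mxE eqxx.
  by rewrite block_mxEdr.
- rewrite tr_block_mx mulmx_block trmx0 tr_scalar_mx.
  rewrite !mul0mx !mulmx0 !addr0 -TE GE.
  rewrite -scalar_mxM ss mul_scalar_mx scalerA sV scale1r.
  rewrite [(_ *: b)^T]linearZ /= mul_mx_scalar scalerA sV scale1r.
  rewrite -scalemxAl -scalemxAr scalerA -invfM ss.
  by rewrite addrC subrK.
Qed.

Lemma cholP n (G : 'M[R]_n) : G^T = G ->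
  (forall v : 'cV_n, v != 0 -> 0 < (v^T *m G *m v) 0 0) ->
  [/\ upper_trapezoidal (chol G), forall i, 0 < chol G i i &
      G = (chol G)^T *m chol G].
Proof. by move=> Gt Gpos; exact: xgetPex (cholesky_exists Gt Gpos). Qed.

End Cholesky.

(** * Slices and blocks *)

Section Slices.
Variable R : realType.

(** The coordinate embedding of R^p into R^n starting at coordinate r. Writing
    slices with it turns block computations into matrix algebra, without casts
    between the dimensions n and l + (n - l). *)
Definition coord_embed r p n : 'M[R]_(n, p) :=
  \matrix_(i, j) ((i : nat) == (r + j)%N)%:R.

Lemma sliceE r0 c0 p q m n (A : 'M[R]_(m, n)) :
  slice r0 c0 p q A = (coord_embed r0 p m)^T *m A *m coord_embed c0 q n.
Proof.
have rowE' k (B : 'M[R]_(m, k)) i j : ((coord_embed r0 p m)^T *m B) i j =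
    if insub (r0 + i)%N is Some i' then B i' j else 0.
  rewrite mxE; case: insubP => [i' _ i'E|im].
    rewrite (bigD1 i')//= big1 ?addr0 => [|a ai]; rewrite !mxE.
      by rewrite i'E eqxx mul1r.
    by rewrite -i'E val_eqE (negPf ai) mul0r.
  rewrite big1// => a _; rewrite !mxE; case: eqP => [E|]; last by rewrite mul0r.
  by rewrite -E ltn_ord in im.
have colE' k (B : 'M[R]_(k, n)) i j : (B *m coord_embed c0 q n) i j =
    if insub (c0 + j)%N is Some j' then B i j' else 0.
  rewrite mxE; case: insubP => [j' _ j'E|jn].
    rewrite (bigD1 j')//= big1 ?addr0 => [|a aj]; rewrite !mxE.
      by rewrite j'E eqxx mulr1.
    by rewrite -j'E val_eqE (negPf aj) mulr0.
  rewrite big1// => a _; rewrite !mxE; case: eqP => [E|]; last by rewrite mulr0.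
  by rewrite -E ltn_ord in jn.
apply/matrixP => i j; rewrite mxE -mulmxA rowE'; case: insub => [i'|//].
by rewrite colE'.
Qed.

Lemma coord_embed_full n : coord_embed 0 n n = 1%:M.
Proof. by apply/matrixP => i j; rewrite !mxE. Qed.

Lemma coord_embed_isometry r p n : (r + p <= n)%N ->
  (coord_embed r p n)^T *m coord_embed r p n = 1%:M.
Proof.
move=> rpn; apply/matrixP => i j; rewrite !mxE.
have ri : (r + i < n)%N by rewrite (leq_trans _ rpn)// ltn_add2l.
rewrite (bigD1 (Ordinal ri))//= big1 ?addr0 => [|a ai]; rewrite !mxE /=.
  by rewrite eqxx mul1r eqn_add2l.
by rewrite -val_eqE in ai; rewrite (negPf ai) mul0r.
Qed.

Lemma coord_embed_partition l n : (l <= n)%N ->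
  coord_embed 0 l n *m (coord_embed 0 l n)^T +
  coord_embed l (n - l) n *m (coord_embed l (n - l) n)^T = 1%:M.
Proof.
move=> ln; apply/matrixP => i j; rewrite !mxE.
have [il|li] := ltnP i l.
  rewrite (bigD1 (Ordinal il))//= big1 => [|a ai];
    rewrite ?mxE /= ?eqxx; last first.
    by rewrite add0n eq_sym; rewrite -val_eqE in ai; rewrite (negPf ai) mul0r.
  rewrite big1 ?addr0 => [|a ai]; rewrite ?mxE.
    by rewrite mul1r [j == i :> nat]eq_sym.
  by rewrite ltn_eqF ?mul0r// ltn_addr.
have iln : (i - l < n - l)%N by rewrite ltn_sub2r// (leq_ltn_trans li).
rewrite big1 ?add0r => [|a ai]; rewrite ?mxE; last first.
  by rewrite add0n gtn_eqF ?mul0r// (leq_trans _ li).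
rewrite (bigD1 (Ordinal iln))//= big1 ?addr0 => [|a ai];
  rewrite ?mxE /= ?subnKC ?eqxx//.
  by rewrite mul1r [j == i :> nat]eq_sym.
rewrite -[X in X == _](subnKC li) eqn_add2l eq_sym.
by rewrite -val_eqE in ai; rewrite (negPf ai) mul0r.
Qed.

Lemma upper_trapezoidalP m n (A : 'M[R]_(m, n)) :
  reflect (forall (i : 'I_m) (j : 'I_n), (j < i)%N -> A i j = 0)
          (upper_trapezoidal A).
Proof.
apply: (iffP is_trig_mxP) => Atrig i j ji.
  by have := Atrig j i ji; rewrite mxE.
by rewrite mxE; exact: Atrig.
Qed.

Lemma upper_trapezoidalM m n p (A : 'M[R]_(m, n)) (B : 'M[R]_(n, p)) :
  upper_trapezoidal A -> upper_trapezoidal B -> upper_trapezoidal (A *m B).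
Proof.
move=> /upper_trapezoidalP Au /upper_trapezoidalP Bu.
apply/upper_trapezoidalP => i j ji.
rewrite mxE big1// => a _; have [ai|ia] := ltnP a i; first by rewrite Au ?mul0r.
by rewrite Bu ?mulr0// (leq_trans ji).
Qed.

Lemma upper_trapezoidal_blockD l k n (A : 'M[R]_(k, n)) :
  upper_trapezoidal A ->
  (coord_embed l (k - l) k)^T *m A *m coord_embed 0 l n = 0.
Proof.
move=> /upper_trapezoidalP Au; rewrite -sliceE.
apply/matrixP => i j; rewrite !mxE.
case: insubP => // i' _ i'E; case: insubP => // j' _ j'E; apply: Au.
by rewrite i'E j'E add0n ltn_addr.
Qed.

Section Blocks.
Variables (l k n : nat) (T : 'M[R]_k) (A : 'M[R]_(k, n)).
Hypotheses (lk : (l <= k)%N) (Tu : upper_trapezoidal T).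
Hypothesis Au : upper_trapezoidal A.

Let split_mul p q (X : 'M[R]_(p, k)) (Y : 'M[R]_(k, q)) :
  X *m Y = X *m coord_embed 0 l k *m ((coord_embed 0 l k)^T *m Y) +
    X *m coord_embed l (k - l) k *m ((coord_embed l (k - l) k)^T *m Y).
Proof.
rewrite -[in LHS](mulmx1 X) -(coord_embed_partition lk).
by rewrite mulmxDr mulmxDl !mulmxA.
Qed.

Lemma blockA_mul : blockA l (T *m A) = blockA l T *m blockA l A.
Proof.
rewrite /blockA !sliceE mulmxA split_mul mulmxDl.
rewrite -[X in _ + X]mulmxA (upper_trapezoidal_blockD l Au).
by rewrite mulmx0 addr0 !mulmxA.
Qed.

Lemma blockB_mul :
  blockB l (T *m A) = blockA l T *m blockB l A + blockB l T *m blockC l A.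
Proof.
rewrite /blockA /blockB /blockC !sliceE mulmxA split_mul.
by rewrite mulmxDl !mulmxA.
Qed.

Lemma blockC_mul : blockC l (T *m A) = blockC l T *m blockC l A.
Proof.
rewrite /blockC !sliceE mulmxA split_mul mulmxDl.
by rewrite (upper_trapezoidal_blockD l Tu) !mul0mx add0r !mulmxA.
Qed.

(** T maps the span of the first l coordinate vectors to itself, and acts on it
    as its leading block. *)
Lemma norm2_blockA x :
  norm2 (blockA l T *m x) = norm2 (T *m (coord_embed 0 l k *m x)).
Proof.
rewrite /blockA sliceE.
have -> : T *m (coord_embed 0 l k *m x) = coord_embed 0 l k *m
    ((coord_embed 0 l k)^T *m T *m coord_embed 0 l k *m x).
  rewrite -[LHS]mul1mx -(coord_embed_partition lk) mulmxDl.
  rewrite -[X in _ + X]mulmxA !mulmxA -2!(mulmxA (coord_embed l _ k)).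
  by rewrite (upper_trapezoidal_blockD l Tu) mulmx0 mul0mx addr0.
by rewrite [RHS]norm2_isometry ?coord_embed_isometry.
Qed.

Lemma norm2_blockB_le x :
  norm2 (blockB l T *m x) <= norm2 (T *m (coord_embed l (k - l) k *m x)).
Proof.
rewrite /blockB sliceE -!mulmxA; apply: norm2_trmx_le.
by rewrite coord_embed_isometry.
Qed.

Lemma norm2_blockC_le x :
  norm2 (blockC l T *m x) <= norm2 (T *m (coord_embed l (k - l) k *m x)).
Proof.
rewrite /blockC sliceE -!mulmxA; apply: norm2_trmx_le.
by rewrite coord_embed_isometry// subnKC.
Qed.

End Blocks.

End Slices.

(** * Norm bounds and sketching *)

Section Sketching.
Variable R : realType.

Lemma expanding_unitmx n (A : 'M[R]_n) s : 0 < s ->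
  (forall v, s * norm2 v <= norm2 (A *m v)) -> A \in unitmx.
Proof.
move=> s_gt0 As; apply: inj_unitmx => v Av0; have := As v.
rewrite Av0 norm20 pmulr_rle0// => v0; apply/eqP; rewrite -norm2_eq0.
by rewrite eq_le v0 norm2_ge0.
Qed.

Lemma expanding_invmx n (A : 'M[R]_n) s v : 0 < s ->
  (forall v, s * norm2 v <= norm2 (A *m v)) ->
  norm2 (invmx A *m v) <= s^-1 * norm2 v.
Proof.
move=> s_gt0 As; rewrite ler_pdivlMl//; apply: le_trans (As _) _.
by rewrite mulmxA mulmxV ?mul1mx// (expanding_unitmx s_gt0 As).
Qed.

(** With U an orthonormal basis of the range of M, these are the bounds on
    |S U y| / |y| given by the extreme singular values of S U. *)
Lemma kappa_bounds d m n (S : 'M[R]_(d, m)) (M : 'M[R]_(m, n)) c :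
  (\rank M <= d)%N -> kappa S M^T = c%:E ->
  exists s1 s2, [/\ 0 < s1, s1 <= s2, c = s2 / s1,
    forall x : 'cV_n, s1 * norm2 (M *m x) <= norm2 (S *m M *m x) &
    forall x : 'cV_n, norm2 (S *m M *m x) <= s2 * norm2 (M *m x)].
Proof.
rewrite -mxrank_tr; have [] := orthonormal_basisP M^T.
rewrite /kappa; move: (orthonormal_basis _).
move: (\rank _) => r U UU /eqmxP UM rd.
have /submxP[D /(congr1 trmx)] : (M^T <= U^T)%MS by rewrite UM.
rewrite trmx_mul !trmxK => ME; rewrite /cond.
have sz : size (singular_values (S *m U)) = r.
  have [szE _] := symmetric_diagonalization (gram_sym (S *m U)).
  by rewrite size_takel ?size_map ?szE ?(minn_idPr rd).
(* If M = 0 then kappa is 1 by convention. *)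
have [r0|r_gt0] := posnP r.
  rewrite (size0nil (etrans sz r0)) /= oner_eq0 divr1 => -[<-].
  have M0 (x : 'cV_n) : M *m x = 0.
    rewrite ME -mulmxA; suff -> : D^T *m x = 0 by rewrite mulmx0.
    by apply/colP => i; have := ltn_ord i; rewrite {2}r0.
  exists 1, 1; split=> [|||x|x]; rewrite ?divr1//.
    by rewrite -mulmxA M0 mulmx0 !norm20 mulr0.
  by rewrite -mulmxA M0 mulmx0 !norm20 mulr0.
have -> : head 1 (singular_values (S *m U)) = sigma 1 (S *m U).
  by rewrite /sigma -nth0; apply: set_nth_default; rewrite sz.
have -> : last 1 (singular_values (S *m U)) = sigma r (S *m U).
  by rewrite /sigma -nth_last sz; apply: set_nth_default; rewrite sz prednK.
case: eqP => // /eqP s0 [<-].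
exists (sigma r (S *m U)), (sigma 1 (S *m U)); split=> //.
- by rewrite lt_def s0 sigma_ge0.
- exact: sigma_antitone.
- move=> x; rewrite ME -!mulmxA (norm2_isometry _ UU) mulmxA.
  exact: sigman_le_norm2.
- move=> x; rewrite ME -!mulmxA (norm2_isometry _ UU) mulmxA.
  exact: norm2_le_sigma1.
Qed.

(** To be used with the sketch X = S M, its R-factor A and the Cholesky factor
    T. The same two constants compare M with X and T with the identity; all
    bounds follow from the block products of T A. *)
Lemma rrqr_bounds_transfer m d n k l (M : 'M[R]_(m, n)) (X : 'M[R]_(d, n))
    (T : 'M[R]_k) (A : 'M[R]_(k, n)) s1 s2 f g :
  (n <= d)%N -> (n <= m)%N -> (1 <= l <= k)%N -> (l <= \rank X)%N ->
  upper_trapezoidal T -> upper_trapezoidal A ->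
  0 < s1 -> s1 <= s2 ->
  (forall v, s1 * norm2 (M *m v) <= norm2 (X *m v)) ->
  (forall v, norm2 (X *m v) <= s2 * norm2 (M *m v)) ->
  (forall x, s1 * norm2 (T *m x) <= norm2 x) ->
  (forall x, norm2 x <= s2 * norm2 (T *m x)) ->
  [/\ 1 <= f,
      forall j, (1 <= j <= l)%N -> sigma j X / f <= sigma j (blockA l A),
      forall j, (1 <= j <= k - l)%N ->
        sigma j (blockC l A) <= f * sigma (l + j) X &
      spectral_norm (invmx (blockA l A) *m blockB l A) <= g] ->
  [/\ 1 <= s2 / s1 * f,
      forall j, (1 <= j <= l)%N ->
        sigma j M / (s2 / s1 * f) <= sigma j (blockA l (T *m A)),
      forall j, (1 <= j <= k - l)%N ->
        sigma j (blockC l (T *m A)) <= s2 / s1 * f * sigma (l + j) M &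
      spectral_norm (invmx (blockA l (T *m A)) *m blockB l (T *m A)) <=
        g + s2 / s1 * f ^+ 2].
Proof.
move=> nd nm /andP[l_gt0 lk] lX Tu Au s1_gt0 s12 MX XM Ts1 Ts2 [f1 fA fC gB].
have s2_gt0 : 0 < s2 by exact: lt_le_trans s12.
have f_gt0 : 0 < f by exact: lt_le_trans f1.
have minE : minn m n = minn d n by rewrite (minn_idPr nm) (minn_idPr nd).
have sMX j : s1 * sigma j M <= sigma j X.
  rewrite -ler_pdivlMl//; apply: sigma_monotone => // [|v].
    by rewrite invr_ge0 ltW.
  by rewrite ler_pdivlMl.
have sXM j : sigma j X <= s2 * sigma j M.
  by apply: sigma_monotone => //; exact: ltW.
have TA v : norm2 v <= s2 * norm2 (blockA l T *m v).
  rewrite norm2_blockA// (le_trans _ (Ts2 _))// norm2_isometry//.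
  exact: coord_embed_isometry.
have Te2 v : s1 * norm2 (T *m (coord_embed R l (k - l) k *m v)) <= norm2 v.
  rewrite (le_trans (Ts1 _))// norm2_isometry//.
  by rewrite coord_embed_isometry// subnKC.
have TC v : s1 * norm2 (blockC l T *m v) <= norm2 v.
  by apply: le_trans (Te2 v); rewrite ler_pM2l// norm2_blockC_le.
have TB v : s1 * norm2 (blockB l T *m v) <= norm2 v.
  by apply: le_trans (Te2 v); rewrite ler_pM2l// norm2_blockB_le.
have c1 : 1 <= s2 / s1 by rewrite ler_pdivlMr// mul1r.
rewrite blockA_mul// blockB_mul// blockC_mul//; split.
- by rewrite -[1]mulr1 ler_pM.
- move=> j jl; rewrite ler_pdivrMr ?mulr_gt0 ?invr_gt0//.
  have sA : sigma j (blockA l A) <= s2 * sigma j (blockA l T *m blockA l A).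
    by apply: sigma_monotone => // [|v]; [exact: ltW | rewrite -mulmxA].
  have := fA j jl; rewrite ler_pdivrMr// => fAj.
  rewrite -(ler_pM2l s1_gt0).
  have -> a : s1 * (a * (s2 / s1 * f)) = s2 * a * f by field; rewrite gt_eqF.
  by apply: le_trans (sMX j) (le_trans fAj _); rewrite ler_pM2r.
- move=> j jkl; have := fC j jkl => fCj.
  have sC : s1 * sigma j (blockC l T *m blockC l A) <= sigma j (blockC l A).
    rewrite -ler_pdivlMl//; apply: sigma_monotone => // [|v].
      by rewrite invr_ge0 ltW.
    by rewrite ler_pdivlMl// -mulmxA.
  rewrite -(ler_pM2l s1_gt0); apply: le_trans sC (le_trans fCj _).
  have -> a : s1 * (s2 / s1 * f * a) = f * (s2 * a) by field; rewrite gt_eqF.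
  by rewrite ler_pM2l.
have sl_gt0 : 0 < sigma l X by rewrite sigma_gt0// l_gt0.
have AR v : sigma l X / f * norm2 v <= norm2 (blockA l A *m v).
  apply: le_trans (sigman_le_norm2 (blockA l A) v (leqnn l)).
  by rewrite ler_wpM2r ?norm2_ge0// fA// l_gt0 /=.
have ATA v : s2^-1 * norm2 v <= norm2 (blockA l T *m v) by rewrite ler_pdivrMl.
have slf_gt0 : 0 < sigma l X / f by rewrite divr_gt0.
have s2V_gt0 : 0 < s2^-1 by rewrite invr_gt0.
(* For l = k the block C is empty; otherwise its norm is at most
   f sigma_(l+1)(X), and sigma_(l+1)(X) <= sigma_l(X). *)
have CR v : norm2 (blockC l A *m v) <= f * sigma l X * norm2 v.
  have [kl0|kl_gt0] := posnP (k - l)%N.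
    have -> : blockC l A *m v = 0.
      by apply/colP => i; have := ltn_ord i; rewrite {2}kl0.
    by rewrite norm20 !mulr_ge0 ?sigma_ge0 ?norm2_ge0// ltW.
  apply: le_trans (norm2_le_sigma1 _ _) _; rewrite ler_wpM2r ?norm2_ge0//.
  apply: (le_trans (fC 1%N _)); first by rewrite kl_gt0.
  by rewrite ler_pM2l// sigma_antitone// leq_addr.
have uA := expanding_unitmx slf_gt0 AR; have uT := expanding_unitmx s2V_gt0 ATA.
apply: spectral_norm_le => [|x].
  apply: addr_ge0; first exact: le_trans (spectral_norm_ge0 _) gB.
  by rewrite mulr_ge0 ?sqr_ge0// (le_trans ler01).
rewrite invmxM//.
have -> : invmx (blockA l A) *m invmx (blockA l T) *m
    (blockA l T *m blockB l A + blockB l T *m blockC l A) *m x =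
  invmx (blockA l A) *m blockB l A *m x +
  invmx (blockA l A) *m
    (invmx (blockA l T) *m (blockB l T *m (blockC l A *m x))).
  by rewrite mulmxDr mulmxDl !mulmxA mulmxKV.
rewrite mulrDl; apply: le_trans (norm2D _ _) _; apply: lerD.
  by apply: le_trans (norm2_le_spectral _ _) _; rewrite ler_wpM2r ?norm2_ge0.
apply: le_trans (expanding_invmx _ slf_gt0 AR) _.
rewrite ler_pdivrMl//; apply: le_trans (expanding_invmx _ s2V_gt0 ATA) _.
rewrite invrK -(ler_pM2l s1_gt0) mulrCA.
apply: le_trans (_ : s2 * (f * sigma l X * norm2 x) <= _).
  by rewrite ler_pM2l//; exact: le_trans (TB _) (CR _).
rewrite le_eqVlt; apply/orP; left; apply/eqP; field.
by rewrite !gt_eqF.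
Qed.

(** Step (3) of the algorithm recomputes k as the rank of the R-factor; this
    equation identifies it with the inner dimension of the factorization. *)
Lemma cqrrpt_coreE m n d (qrcp : 'M[R]_(d, n) -> qrcp_output R d n)
    (S : 'M[R]_(d, m)) (M : 'M[R]_(m, n)) k Q A J :
  qrcp (S *m M) = @QRCPOutput R d n k Q A J -> \rank A = k ->
  let Mpre := col_perm J M *m coord_embed R 0 k n *m invmx (blockA k A) in
  let T := chol (Mpre^T *m Mpre) in
  cqrrpt_core qrcp S M = @QRCPOutput R m n k (Mpre *m invmx T) (T *m A) J.
Proof.
move=> oE rk; rewrite /cqrrpt_core oE /=; move: (\rank A) rk => k' k'E.
case: k / k'E Q A {oE} => Q A.
have sA : slice 0 0 k' n A = A.
  by rewrite sliceE !coord_embed_full trmx1 mulmx1 mul1mx.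
have sM : slice 0 0 m k' (col_perm J M) =
    col_perm J M *m coord_embed R 0 k' n.
  by rewrite sliceE coord_embed_full trmx1 mul1mx.
by rewrite sA sM.
Qed.

End Sketching.

Theorem theorem5 (R : realType) (m n d : nat)
    (M : 'M[R]_(m, n)) (S : 'M[R]_(d, m)) (c : R)
    (qrcp : 'M[R]_(d, n) -> qrcp_output R d n) (f g : nat -> R) :
  (n <= d)%N -> (d <= m)%N ->
  kappa S M^T = c%:E ->
  strong_RRQR qrcp (S *m M) f g ->
  \rank (S *m M) = \rank M /\
  strong_RRQR (cqrrpt_core qrcp S) M
    (fun l => c * f l) (fun l => g l + c * f l ^+ 2).
Proof.
move=> nd dm cE [_ qrcp_SM qrcp_bounds].
have rMd : (\rank M <= d)%N by rewrite (leq_trans (rank_leq_col M)).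
have [s1 [s2 [s1_gt0 s12 -> lowS upS]]] := kappa_bounds rMd cE.
have s2_gt0 : 0 < s2 by exact: lt_le_trans s12.
have Sinj p (Y : 'M[R]_(n, p)) : S *m (M *m Y) = 0 -> M *m Y = 0.
  move=> SY; apply/matrixP => i j; have : norm2 (M *m (Y *m delta_mx j 0)) == 0.
    rewrite eq_le norm2_ge0 andbT -(ler_pM2l s1_gt0) mulr0.
    apply: le_trans (lowS _) _.
    by rewrite -mulmxA !(mulmxA M) (mulmxA S) SY mul0mx norm20.
  by rewrite norm2_eq0 mulmxA -colE => /eqP/colP/(_ i); rewrite !mxE.
have rSM : \rank (S *m M) = \rank M.
  apply/eqP; rewrite eqn_leq mxrankM_maxr /=.
  (* S M and M have the same kernel. *)
  have kerS : M *m cokermx (S *m M) = 0.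
    by apply: Sinj; rewrite mulmxA mulmx_coker.
  have := mulmx0_rank_max kerS; rewrite mxrank_coker.
  by rewrite addnBA ?rank_leq_col// leq_subLR leq_add2r.
split=> //.
case oE: (qrcp (S *m M)) qrcp_SM qrcp_bounds => [k Q A J].
move=> [/= kE QQ Au XE] bounds.
have JE p (Y : 'M[R]_(p, n)) : col_perm J Y = Y *m perm_mx J^-1.
  by rewrite col_permE.
have rA : \rank A = k.
  apply/eqP; rewrite eqn_leq rank_leq_row {1}kE.
  rewrite -(mxrankMfree (S *m M) (_ : row_free (perm_mx J^-1))).
    by rewrite -JE XE mxrankM_maxr.
  by rewrite row_free_unit unitmx_perm.
(* The call is replaced by its value before the definition of the property is
   unfolded, which would otherwise expand the algorithm. *)
move: (cqrrpt_core qrcp S) (cqrrpt_coreE oE rA) => core coreE.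
rewrite /strong_RRQR coreE /= {core coreE}.
set E := coord_embed R 0 k n; set A1 := blockA k A.
have A1E : A1 = A *m E.
  by rewrite /A1 /blockA sliceE coord_embed_full trmx1 mul1mx.
have uA1 : A1 \in unitmx.
  have [k0|k_gt0] := posnP k.
    apply: inj_unitmx => v _; apply/colP => i.
    by have := ltn_ord i; rewrite {2}k0.
  have [|f1 fA _ _] := bounds k; first by rewrite k_gt0 leqnn.
  have s_gt0 : 0 < sigma k A1.
    apply: lt_le_trans (fA k _); last by rewrite k_gt0 leqnn.
    apply: divr_gt0; last exact: lt_le_trans f1.
    by rewrite sigma_gt0// k_gt0 -kE leqnn.
  by apply: expanding_unitmx s_gt0 _ => v; exact: sigman_le_norm2.
(* The preconditioned matrix is M Y. *)
pose Y := perm_mx J^-1 *m E *m invmx A1.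
have -> : col_perm J M *m E *m invmx A1 = M *m Y by rewrite JE /Y !mulmxA.
have SMY : S *m M *m Y = Q.
  by rewrite /Y !mulmxA -JE XE -(mulmxA Q) -A1E mulmxK.
clearbody Y.
set T := chol _.
have nMY v : norm2 (S *m M *m (Y *m v)) = norm2 v.
  by rewrite mulmxA SMY norm2_isometry.
have [Tu _ TE] : [/\ upper_trapezoidal T, forall i, 0 < T i i &
    (M *m Y)^T *m (M *m Y) = T^T *m T].
  apply: cholP; first exact: gram_sym.
  move=> v v0; rewrite gram_form exprn_gt0// lt_def norm2_ge0 andbT.
  apply: contra v0; rewrite norm2_eq0 -mulmxA => /eqP MYv0.
  by rewrite -norm2_eq0 -nMY -mulmxA MYv0 mulmx0 norm20.
have nT v : norm2 (T *m v) = norm2 (M *m (Y *m v)).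
  have gramE p (B : 'M[R]_(p, k)) :
      (B *m v)^T *m (B *m v) = v^T *m (B^T *m B) *m v.
    by rewrite trmx_mul !mulmxA.
  by apply: norm2_eq; rewrite (mulmxA M) !gramE TE.
have lowT v : s1 * norm2 (T *m v) <= norm2 v by rewrite nT -(nMY v) lowS.
have upT v : norm2 v <= s2 * norm2 (T *m v) by rewrite nT -{1}(nMY v) upS.
have uT : T \in unitmx.
  apply: (@expanding_unitmx _ _ _ s2^-1); first by rewrite invr_gt0.
  by move=> v; rewrite ler_pdivrMl.
split; first exact: leq_trans nd dm.
- split=> /=; first by rewrite kE.
  + rewrite /Defs.orthonormal trmx_mul mulmxA -(mulmxA _ _ (M *m Y)) TE.
    by rewrite trmx_inv !mulmxA mulVmx ?unitmx_tr// mul1mx mulmxV.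
  + exact: upper_trapezoidalM.
  + rewrite mulmxA mulmxKV// JE; apply/eqP; rewrite -subr_eq0 -mulmxA -mulmxBr.
    by apply/eqP/Sinj; rewrite mulmxBr mulmxBr !mulmxA -JE XE SMY subrr.
- move=> l /andP[l_gt0 lk].
  apply: (@rrqr_bounds_transfer _ _ _ _ _ _ _ (S *m M)) => //.
  + exact: leq_trans nd dm.
  + by rewrite l_gt0.
  + by rewrite -kE.
  + by apply: bounds; rewrite l_gt0.
Qed.
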